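(* Let $X$ be a smooth projective toric variety with total coordinate ring $S$ and let $d\in\operatorname{Pic}X$ be nef. Let $F_\bullet$ be the cellular complex of free $S$-modules on the labeled cell complex $D$ associated to $d$, and let $\Phi(S(d))$ be the complex of free $S$-modules associated to the Fourier--Mukai transform of $S(d)$ with the resolution of the diagonal $G_\bullet$ of Hanlon, Hicks, and Lazarev (all defined in the context), where the incidence functions used for $F_\bullet$ and $G_\bullet$ come from the same $\varepsilon$. Then the twist $F(d)_\bullet$ is isomorphic, as a complex of graded $S$-modules, to $\Phi(S(d))$.
   Context: Toric setup. $X$ is a smooth projective toric variety over an algebraically closed field $k$, given by a fan of full dimension. $M$ is the character lattice, $N$ the lattice of one-parameter subgroups, $\langle\cdot,\cdot\rangle:M\times N\to\mathbb Z$ the pairing, and $u_1,\dots,u_r\in N$ the primitive ray generators. $S=k[x_1,\dots,x_r]$ is the total coordinate (Cox) ring, graded by $\operatorname{Pic}X$ with $\deg x_i$ the class of the torus-invariant divisor of $u_i$; $x^\alpha=\prod x_i^{\alpha_i}$ for $\alpha\in\mathbb Z^r$ (Laurent monomials allowed), and $\deg x^\alpha\in\operatorname{Pic}X$. Twists: $S(a)_b=S_{a+b}$. The exact sequence $0\to M\to\mathbb Z^r\to\operatorname{Pic}X\to0$ has first map $m\mapsto(\langle m,u_1\rangle,\dots,\langle m,u_r\rangle)$; via it $M$ and $M\otimes\mathbb R$ are identified with their images in $\mathbb Z^r$ and $\mathbb R^r$. $\lceil\cdot\rceil$ and $\lfloor\cdot\rfloor$ are componentwise. The complex $D$. Fix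 $\alpha\in\mathbb Z^r$ with $\deg x^\alpha=d$. Let $C$ be the cell structure on $\mathbb R^r$ whose codimension 1 skeleton is the union of the hyperplanes $\{\beta_i=n\}$, $1\le i\le r$, $n\in\mathbb Z$. Restricting $C$ to the affine space $\alpha+M\otimes\mathbb R$ gives a polyhedral cell structure whose (relatively) open cells are the nonempty intersections of open cells of $C$ with $\alpha+M\otimes\mathbb R$. $D$ is the (finite) subcomplex of those cells contained in $\mathbb R^r_{\ge0}$. Label a cell of $D$ by $x^{\lceil\beta\rceil}$ for any $\beta$ in its relative interior (independent of the choice of $\beta$). Incidence functions. An incidence function $\varepsilon$ assigns to a cell $\sigma$ and a codimension 1 face $\tau$ of it a sign $\varepsilon(\sigma,\tau)\in\{\pm1\}$ (and $0$ for other pairs), as for the cellular chain complex of a regular cell complex (oriented boundary signs). Fix one on the restriction of $C$ to $M\otimes\mathbb R$ that is invariant under simultaneous translation of pairs of cells by $M$; translation by $\alpha$ transports it to $D$. This same $\varepsilon$ is used for both complexes below. The complex $F_\bullet$. $F_i=\bigoplus_{\dim\sigma=i}S(-\deg\ell_\sigma)e_\sigma$, the sum over cells $\sigma$ of $D$ of dimension $i$ with label $\ell_\sigma$, and $\partial e_\sigma=\sum_\tau\varepsilon(\sigma,\tau)\frac{\ell_\sigma}{\ell_\tau}e_\tau$, the sum over codimension 1 faces $\tau$ of $\sigma$. $F(d)_\bullet$ is its twist by $d$. The Hanlon--Hicks--Lazarev complex $G_\bullet$. Let $R=S\otimes_kS$ be the Cox ring of $X\times X$. Let $E$ be the cell structure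 on the torus $(M\otimes\mathbb R)/M$ induced by the restriction of $C$ to $M\otimes\mathbb R$. $G_j$ is the direct sum, over cells of $E$ of dimension $j$ (represented by a cell $\sigma$ of $M\otimes\mathbb R$ with interior point $\gamma$), of $S(\deg x^{\lfloor-\gamma\rfloor})\otimes_kS(\deg x^{\lfloor\gamma\rfloor})$, and the differential on the summand of $\sigma$ is the sum, over codimension 1 faces $\tau$ of $\sigma$ in $M\otimes\mathbb R$ with interior point $\delta$, of the maps to the summand of the image of $\tau$ in $E$ given by multiplication by $\varepsilon(\sigma,\tau)\,x^{\lceil\gamma\rceil-\lceil\delta\rceil}\otimes x^{\lfloor\delta\rfloor-\lfloor\gamma\rfloor}$. Its sheafification $\tilde G_\bullet$ resolves the structure sheaf of the diagonal of $X\times X$. The complex $\Phi(S(d))$. With $p,q:X\times X\to X$ the first and second projections, for $d$ nef the transform $Rp_*(Lq^*\mathcal O(d)\otimes^L\tilde G_\bullet)$ is computed by a single row of a spectral sequence, namely the complex $p_*(q^*\mathcal O(d)\otimes\tilde G_\bullet)$; $\Phi(S(d))$ is the complex of graded $S$-modules obtained from this row by applying $\Gamma_*=\bigoplus_{d'\in\operatorname{Pic}X}\Gamma(X,-(d'))$. Explicitly, $\Phi(S(d))_j$ is the direct sum over the $j$-dimensional cells of $E$ (with representative interior points $\gamma$) of $S(\deg x^{\lfloor-\gamma\rfloor})\otimes_kS_{d+\deg x^{\lfloor\gamma\rfloor}}$, and the differential is the sum over codimension 1 faces $\tau$ (with interior points $\delta$) of the maps $\varepsilon(\sigma,\tau)\,x^{\lceil\gamma\rceil-\lceil\delta\rceil}\otimes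 x^{\lfloor\delta\rfloor-\lfloor\gamma\rfloor}$ to $S(\deg x^{\lfloor-\delta\rfloor})\otimes_kS_{d+\deg x^{\lfloor\delta\rfloor}}$, acting by multiplication in each factor. *)

(* Defs.v *)
From HB Require Import structures.
From mathcomp Require Import all_boot all_order all_algebra.
From mathcomp Require Import finmap mpoly.
From mathcomp Require Import boolp classical_sets cardinality reals.
From mathcomp Require Import ring.

Set Implicit Arguments.
Unset Strict Implicit.
Unset Printing Implicit Defensive.

Import Order.TTheory GRing.Theory Num.Theory.
Local Open Scope classical_set_scope.
Local Open Scope ring_scope.
Local Open Scope quotient_scope.

(* Conventions.  N = Z^n consists of column vectors, its dual M of row vectors,
   with pairing <m, u> = m *m u.  Column i of [rays] is the primitive generator
   u_i, so [m *m rays] is the image of m under the map M -> Z^r. *)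

Record fan (n r : nat) := Fan {
  rays : 'M[int]_(n, r);
  (* the cone spanned by the u_i, i in A, is recorded as the set A *)
  cones : {set {set 'I_r}} }.

Section Fans.
Variables (R : realType) (n r : nat) (X : fan n r).

Definition realrays : 'M[R]_(n, r) := map_mx intr (rays X).

Definition cone (A : {set 'I_r}) : set 'cV[R]_n :=
  [set v | exists2 t : 'I_r -> R,
     (forall i, 0 <= t i) & v = \sum_(i in A) t i *: col i realrays].

(* cone B is the face of cone A cut out by the supporting form m *)
Definition cone_face (A B : {set 'I_r}) : Prop :=
  exists m : 'rV[R]_n, (forall i, i \in A -> 0 <= (m *m realrays) 0 i) /\
    B = [set i in A | (m *m realrays) 0 i == 0].

Record is_fan : Prop := IsFan {
  fan_primitive : forall i (c : int) (v : 'cV[int]_n),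
    col i (rays X) = c *: v -> `|c| = 1;
  fan_rays : forall i, [set i]%SET \in cones X;
  fan_pointed : forall A, A \in cones X ->
    forall v, cone A v -> cone A (- v) -> v = 0;
  fan_extremal : forall A i, A \in cones X -> i \in A ->
    cone_face A [set i]%SET;
  fan_faces : forall A B, A \in cones X -> cone_face A B -> B \in cones X;
  fan_inter : forall A B, A \in cones X -> B \in cones X ->
    [/\ cone_face A (A :&: B)%SET, cone_face B (A :&: B)%SET &
        cone A `&` cone B = cone (A :&: B)%SET] }.

Definition fan_complete : Prop :=
  forall v : 'cV[R]_n, exists2 A, A \in cones X & cone A v.

Definition maximal_cone (A : {set 'I_r}) : bool :=
  maxset (fun B => B \in cones X) A.

(* the generators of every cone are part of a basis of N *)
Definition fan_smooth : Prop :=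
  forall A, A \in cones X -> exists2 B : 'M[int]_n, B \in unitmx &
    exists2 g : 'I_r -> 'I_n, {in A &, injective g} &
      {in A, forall i, col (g i) B = col i (rays X)}.

(* the divisor sum_i a_i D_i has a strictly convex support function *)
Definition ample (a : 'rV[int]_r) : Prop :=
  forall A, maximal_cone A -> exists m : 'rV[int]_n,
    (forall i, i \in A -> (m *m rays X) 0 i = - a 0 i) /\
    (forall i, i \notin A -> - a 0 i < (m *m rays X) 0 i).

Definition fan_projective : Prop := exists a, ample a.

End Fans.

Record smooth_projective_toric (R : realType) (n r : nat) := SmoothProjToric {
  toric_fan :> fan n r;
  toric_is_fan : is_fan R toric_fan;
  toric_smooth : fan_smooth toric_fan;
  toric_complete : fan_complete R toric_fan;
  toric_projective : fan_projective toric_fan }.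

Section Picard.
Variables (n r : nat) (X : fan n r).

Definition imM : {pred 'rV[int]_r} :=
  fun a => `[< exists m : 'rV[int]_n, a = m *m rays X >].

Fact imM_zmod_closed : zmod_closed imM.
Proof.
split; first by apply/asboolP; exists 0; rewrite mul0mx.
move=> _ _ /asboolP[m ->] /asboolP[m' ->]; apply/asboolP.
by exists (m - m'); rewrite mulmxBl.
Qed.

HB.instance Definition _ :=
  GRing.isZmodClosed.Build 'rV[int]_r imM imM_zmod_closed.

Definition Pic : zmodType := {ideal_quot imM}.

(* [deg a] is the class of the Laurent monomial x^a *)
Definition deg (a : 'rV[int]_r) : Pic := \pi_({ideal_quot imM}) a.

(* Nonnegative degree on every torus-invariant curve; these generate the cone of
   curves.  They are the curves of the walls C, the common facets of two maximal
   cones i |: C and j |: C.  The relation u_i + u_j + sum_(l in C) b_l u_l = 0 gives the intersection numbers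
   of the curve of C: they are 1 with D_i and D_j, b_l with D_l for l in C, and
   0 with the other invariant divisors. *)
Definition nef (d : Pic) : Prop :=
  forall (a : 'rV[int]_r) (C : {set 'I_r}) (i j : 'I_r) (b : 'I_r -> int),
    deg a = d -> i != j -> i \notin C -> j \notin C ->
    maximal_cone X (i |: C)%SET -> maximal_cone X (j |: C)%SET ->
    col i (rays X) + col j (rays X)
      + \sum_(l in C) b l *: col l (rays X) = 0 ->
    0 <= a 0 i + a 0 j + \sum_(l in C) b l * a 0 l.

Lemma degD : {morph deg : a b / a + b >-> a + b}.
Proof. by move=> a b; rewrite /deg !piE. Qed.
Lemma degN : {morph deg : a / - a >-> - a}.
Proof. by move=> a; rewrite /deg !piE. Qed.
Lemma deg_eq (a b : 'rV[int]_r) :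
  deg a = deg b <-> exists m : 'rV[int]_n, a - b = m *m rays X.
Proof.
rewrite /deg; split=> [/eqP|H].
  by rewrite -Quotient.idealrBE => /asboolP.
by apply/eqP; rewrite -Quotient.idealrBE; apply/asboolP.
Qed.

End Picard.

Section Cells.
Variables (R : realType) (n r : nat) (X : fan n r).

Implicit Types (a : 'rV[int]_r) (j : nat).

(* C is the cell structure on R^r cut out by the hyperplanes b_i = z, z in Z.
   A relatively open cell of its restriction to a + M_R is determined by the
   common values (floor b, ceil b) of its points b; its label is x^hi.  A pair
   names a cell when [opencell a] of it is nonempty, and then [closedcell a] is
   the closure of that open cell. *)
Definition cell : Type := ('rV[int]_r * 'rV[int]_r)%type.
HB.instance Definition _ := Choice.on cell.
Definition lo (s : cell) : 'rV[int]_r := s.1.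
Definition hi (s : cell) : 'rV[int]_r := s.2.

Definition shift a (s : cell) : cell := (lo s + a, hi s + a).

Definition translateM a : set 'rV[R]_r :=
  [set b | exists m : 'rV[R]_n, b = map_mx intr a + m *m realrays R X].

Definition opencell a (s : cell) : set 'rV[R]_r :=
  [set b | translateM a b /\
     forall i, Num.floor (b 0 i) = lo s 0 i /\ Num.ceil (b 0 i) = hi s 0 i].

Definition closedcell a (s : cell) : set 'rV[R]_r :=
  [set b | translateM a b /\
     forall i, (lo s 0 i)%:~R <= b 0 i <= (hi s 0 i)%:~R].

(* A is nonempty and the span of its differences has dimension j *)
Definition affine_dim (A : set 'rV[R]_r) j : Prop :=
  exists x, exists V : {vspace 'rV[R]_r}, [/\ A x, \dim V = j &
    forall W : {vspace 'rV[R]_r},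
      (V <= W)%VS <-> (forall y, A y -> y - x \in W)].

Definition celldim a j : set cell := [set s | affine_dim (opencell a s) j].

Definition is_facet a (s t : cell) : Prop :=
  closedcell a t `<=` closedcell a s /\
  exists j, celldim a j.+1 s /\ celldim a j t.

Definition facets a (s : cell) : {fset cell} := fset_set (is_facet a s).

(* incidence functions on the restriction of C to M_R, invariant under M; the
   last two equations express that the augmented cellular chain complex with
   boundary signs given by eps is a complex *)
Record incidence := Incidence {
  eps :> cell -> cell -> int;
  eps_sign : forall s t, is_facet 0 s t -> eps s t = 1 \/ eps s t = -1;
  eps_out : forall s t, ~ is_facet 0 s t -> eps s t = 0;
  eps_shift : forall (m : 'rV[int]_n) s t,
    eps (shift (m *m rays X) s) (shift (m *m rays X) t) = eps s t;
  eps_codim2 : forall s q, \sum_(t <- facets 0 s) eps s t * eps t q = 0;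
  eps_edge : forall s, celldim 0 1 s -> \sum_(t <- facets 0 s) eps s t = 0 }.

(* D is the subcomplex of cells of a + M_R contained in the orthant b >= 0. *)
Definition Dset a j : set cell :=
  [set s | celldim a j s /\
     forall b, closedcell a s b -> forall i, 0 <= b 0 i].
Definition Dcell a j : {fset cell} := fset_set (Dset a j).

(* The cells of the induced structure E on the torus M_R / M are the M-orbits
   of cells of M_R. *)
Definition same_orbit : rel cell :=
  fun s t => `[< exists m : 'rV[int]_n, t = shift (m *m rays X) s >].

Fact same_orbit_equiv : equiv_class_of same_orbit.
Proof.
split.
- by case=> f c; apply/asboolP; exists 0; rewrite mul0mx /shift !addr0.
- suff H (s t : cell) : same_orbit s t -> same_orbit t s.
    by move=> s t; apply/idP/idP; apply: H.
  case: s => f c /asboolP[m ->]; apply/asboolP; exists (- m).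
  by rewrite mulNmx /shift /= !addrK.
- move=> t s q /asboolP[m ->] /asboolP[m' ->]; apply/asboolP.
  by exists (m + m'); rewrite mulmxDl /shift /= !addrA.
Qed.
Canonical same_orbit_equivrel := EquivRelPack same_orbit_equiv.

Definition orbit : choiceType := {eq_quot same_orbit}.
Definition orb (s : cell) : orbit := \pi_({eq_quot same_orbit}) s.
Definition orep (o : orbit) : cell := repr (o : {eq_quot same_orbit}).

Definition Ecell j : {fset orbit} := fset_set (orb @` celldim 0 j).

Lemma orepK o : orb (orep o) = o. Proof. exact: reprK. Qed.

Lemma orb_eq s t :
  orb s = orb t <-> exists m : 'rV[int]_n, t = shift (m *m rays X) s.
Proof.
rewrite /orb; split=> [/eqP|H]; first by rewrite eqmodE => /asboolP.
by apply/eqP; rewrite eqmodE; apply/asboolP.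
Qed.

Lemma shiftK a : cancel (shift a) (shift (- a)).
Proof. by case=> f c; rewrite /shift /= !addrK. Qed.
Lemma shiftNK a : cancel (shift (- a)) (shift a).
Proof. by case=> f c; rewrite /shift /= !subrK. Qed.

Lemma lo_shift a s : lo (shift a s) = lo s + a. Proof. by []. Qed.
Lemma hi_shift a s : hi (shift a s) = hi s + a. Proof. by []. Qed.

Lemma opencell_closed a s : opencell a s `<=` closedcell a s.
Proof.
move=> b [bM h]; split=> // i; have [<- <-] := h i.
by rewrite floor_le ceil_ge.
Qed.

Lemma celldim_open a j s : celldim a j s -> exists b, opencell a s b.
Proof. by case=> x [V [xA _ _]]; exists x. Qed.

Lemma celldim_inj a j j' s : celldim a j s -> celldim a j' s -> j = j'.
Proof.
have key (x y : 'rV[R]_r) (V W : {vspace 'rV[R]_r}) (A : set 'rV[R]_r) :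
    A x -> (forall U : {vspace 'rV[R]_r},
      (V <= U)%VS <-> (forall z, A z -> z - x \in U)) ->
    (forall U : {vspace 'rV[R]_r},
      (W <= U)%VS <-> (forall z, A z -> z - y \in U)) -> (V <= W)%VS.
  move=> Ax HV HW; apply/HV => z Az.
  have H := (HW W).1 (subvv W).
  have -> : z - x = (z - y) - (x - y); last by rewrite rpredB ?H.
  by rewrite opprB addrA subrK.
move=> [x [V [xA <- HV]]] [y [W [yA <- HW]]].
by congr (\dim _); apply/eqP; rewrite eqEsubv (key x y V W _ xA HV HW) (key y x W V _ yA HW HV).
Qed.

Lemma translateM_shift a v (b : 'rV[R]_r) :
  translateM (a + v) (b + map_mx intr v) <-> translateM a b.
Proof.
rewrite /translateM /= map_mxD; split=> -[m e]; exists m.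
- by apply: (addIr (map_mx intr v)); rewrite e addrAC.
- by rewrite e addrAC.
Qed.

Lemma translateM_eq a (m : 'rV[int]_n) :
  translateM (a + m *m rays X) = translateM a.
Proof.
apply/seteqP; split=> b /= [m' ->].
  by exists (map_mx intr m + m'); rewrite mulmxDl map_mxD map_mxM addrA.
exists (m' - map_mx intr m); rewrite mulmxBl map_mxD map_mxM /realrays.
by rewrite -addrA subrKC.
Qed.

Lemma opencell_shift a v s (b : 'rV[R]_r) :
  opencell (a + v) (shift v s) (b + map_mx intr v) <-> opencell a s b.
Proof.
split=> -[/translateM_shift bM h]; split=> // i.
- have := h i; rewrite lo_shift hi_shift !mxE.
  rewrite floorDrz ?ceilDrz ?intr_int // intrKfloor intrKceil.
  by case=> /addIr-> /addIr->.
- have [e1 e2] := h i; rewrite lo_shift hi_shift !mxE.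
  by rewrite floorDrz ?ceilDrz ?intr_int // intrKfloor intrKceil e1 e2.
Qed.

Lemma closedcell_shift a v s (b : 'rV[R]_r) :
  closedcell (a + v) (shift v s) (b + map_mx intr v) <-> closedcell a s b.
Proof.
split=> -[/translateM_shift bM h]; split=> // i.
- have := h i; rewrite lo_shift hi_shift !mxE /=.
  by rewrite ![in X in X -> _]rmorphD !lerD2r.
- have := h i; rewrite lo_shift hi_shift !mxE /=.
  by rewrite ![in X in _ -> X]rmorphD !lerD2r.
Qed.

Lemma celldim_shift_imp a v j s :
  celldim a j s -> celldim (a + v) j (shift v s).
Proof.
move=> [x [V [xA dV HV]]]; exists (x + map_mx intr v), V.
split=> // [|W]; first by rewrite opencell_shift.
rewrite HV; split=> H y yA.
- rewrite opprD addrA addrAC; apply: H.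
  by rewrite -(opencell_shift a v) subrK.
- by have := H (y + map_mx intr v); rewrite opencell_shift opprD addrACA subrr addr0; apply.
Qed.

Lemma celldim_shift a v j s : celldim (a + v) j (shift v s) <-> celldim a j s.
Proof.
split=> [|/celldim_shift_imp] // /(celldim_shift_imp (- v)).
by rewrite addrK shiftK.
Qed.

Lemma celldim_eq a (m : 'rV[int]_n) : celldim (a + m *m rays X) = celldim a.
Proof. by rewrite /celldim /opencell translateM_eq. Qed.

Lemma is_facet_shift a v s t :
  is_facet (a + v) (shift v s) (shift v t) <-> is_facet a s t.
Proof.
rewrite /is_facet; split=> -[sub [j [ds dt]]]; split.
- by move=> b; rewrite /= -!(closedcell_shift a v) => /sub.
- by exists j; rewrite -!(celldim_shift a v).
- by move=> b; rewrite -[b](subrK (map_mx intr v)) !closedcell_shift => /sub.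
- by exists j; rewrite !celldim_shift.
Qed.

Lemma is_facet_eq a (m : 'rV[int]_n) :
  is_facet (a + m *m rays X) = is_facet a.
Proof. by rewrite /is_facet /closedcell translateM_eq celldim_eq. Qed.

Lemma facet_bounds a s t i : is_facet a s t ->
  [/\ lo s 0 i <= lo t 0 i, lo t 0 i <= hi t 0 i & hi t 0 i <= hi s 0 i].
Proof.
move=> [sub [j [_ /celldim_open[b bt]]]].
have [_ /(_ i) /andP[h1 h2]] := sub _ (opencell_closed bt).
have [_ /(_ i)[<- <-]] := bt.
rewrite floor_ge_int ceil_le_int h1 h2; split=> //.
by rewrite -(ler_int R) (le_trans (floor_le _)) ?ceil_ge.
Qed.

Lemma finite_box (u w : 'rV[int]_r) :
  finite_set [set v : 'rV[int]_r | forall i, u 0 i <= v 0 i <= w 0 i].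
Proof.
pose N := (\max_(i < r) absz (w ord0 i - u ord0 i)%R)%N.+1.
pose f (g : {ffun 'I_r -> 'I_N}) : 'rV[int]_r := \row_i (u 0 i + (g i : nat)%:Z).
have fin : finite_set (range f) by apply: finite_image; exact: finite_finset.
apply: sub_finite_set fin => v /= Hv.
have vb i : (absz (v ord0 i - u ord0 i)%R < N)%N.
  have /andP[h1 h2] := Hv i.
  rewrite ltnS (leq_trans _ (leq_bigmax i)) // -lez_nat.
  by rewrite !gez0_abs ?subr_ge0 ?lerD2r // (le_trans h1 h2).
exists [ffun i => Ordinal (vb i)] => //.
apply/rowP => i; rewrite !mxE ffunE /= gez0_abs ?subr_ge0; last by case/andP: (Hv i).
by rewrite addrC subrK.
Qed.

Lemma finite_cell_box (u w : 'rV[int]_r) : finite_set [set s : cell |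
  forall i, (u 0 i <= lo s 0 i <= w 0 i) /\ (u 0 i <= hi s 0 i <= w 0 i)].
Proof.
have := finite_setX (finite_box u w) (finite_box u w).
by apply: sub_finite_set => -[f c] /= H; split=> i; case: (H i).
Qed.

Lemma finite_facets a s : finite_set (is_facet a s).
Proof.
apply: sub_finite_set (finite_cell_box (lo s) (hi s)) => t ft i.
have [h1 h2 h3] := facet_bounds i ft.
by rewrite h1 h3 (le_trans h2 h3) (le_trans h1 h2).
Qed.

Lemma in_facets a s t : t \in facets a s <-> is_facet a s t.
Proof.
rewrite /facets in_fset_set; last exact: finite_facets.
by split=> [/set_mem|/mem_set].
Qed.

Lemma finite_Ecell j : finite_set (orb @` celldim 0 j).
Proof.
pose B : 'rV[int]_r := \row_i \sum_l `|rays X l i|.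
apply: sub_finite_set (finite_image (orb) (finite_cell_box (- B) B)).
move=> _ [s ds <-]; have [b bs] := celldim_open ds.
have [[m bE] _] := bs.
pose q : 'rV[int]_n := \row_l Num.floor (m 0 l).
exists (shift (- (q *m rays X)) s); last first.
  by apply/orb_eq; exists q; rewrite shiftNK.
move=> i; move: bs.
rewrite -(opencell_shift 0 (- (q *m rays X))) => -[_ /(_ i)[<- <-]].
set x := (b + _) 0 i.
have /andP[x1 x2] : (- B 0 i)%:~R <= x <= (B 0 i)%:~R.
  rewrite !mxE rmorphN -ler_norml /=.
  have -> : x = \sum_l (m 0 l - (q 0 l)%:~R) * (rays X l i)%:~R.
    rewrite /x bE map_mx0 add0r !mxE rmorphN rmorph_sum /= -sumrB.
    by apply: eq_bigr => l _; rewrite !mxE rmorphM /= mulrBl.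
  rewrite rmorph_sum /=; apply: le_trans (ler_norm_sum _ _ _) _.
  apply: ler_sum => l _; rewrite normrM intr_norm -[leRHS]mul1r.
  rewrite ler_wpM2r // mxE ger0_norm ?subr_ge0 ?floor_le //.
  by rewrite lerBlDl -[1]/(1%:~R) -rmorphD ltW // floorD1_gt.
have h1 : - B 0 i <= Num.floor x by rewrite floor_ge_int.
have h2 : Num.ceil x <= B 0 i by rewrite ceil_le_int.
have h3 : Num.floor x <= Num.ceil x.
  by rewrite -(ler_int R) (le_trans (floor_le _)) ?ceil_ge.
rewrite (_ : (- B) 0 i = - B 0 i); last by rewrite mxE.
by rewrite h1 h2 (le_trans h1 h3) (le_trans h3 h2).
Qed.

Lemma finite_Dset a j : fan_complete R X -> finite_set (Dset a j).
Proof.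
move=> compl.
have bnd i : exists B : int, forall b : 'rV[R]_r,
    translateM a b -> (forall l, 0 <= b 0 l) -> b 0 i <= B%:~R.
  have [A _ [t t0 tE]] := compl (- col i (realrays R X)).
  exists (Num.ceil ((a 0 i)%:~R + \sum_(l in A) t l * (a 0 l)%:~R)).
  move=> b [m bE] b0; apply: le_trans (ceil_ge _).
  have mE l : (m *m col l (realrays R X)) 0 0 = b 0 l - (a 0 l)%:~R.
    by rewrite bE !mxE [RHS]addrC addKr; apply: eq_bigr => p _; rewrite !mxE.
  have := congr1 (fun v => (m *m v) 0 0) tE.
  rewrite mulmxN mxE mE mulmx_sumr summxE => E.
  rewrite -lerBlDl -[leLHS]opprK E -sumrN; apply: ler_sum => l _.
  by rewrite -scalemxAr mxE mE -mulrN opprB ler_wpM2l // gerBl.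
have [B HB] := choice bnd.
apply: sub_finite_set (finite_cell_box 0 (\row_i B i)) => s [ds pos] i.
have [b bs] := celldim_open ds.
have b0 := pos b (opencell_closed bs).
have bB := HB i b bs.1 b0.
have [_ /(_ i)[<- <-]] := bs; rewrite !mxE.
have h1 : 0 <= Num.floor (b 0 i) by rewrite floor_ge0.
have h2 : Num.ceil (b 0 i) <= B i by rewrite ceil_le_int.
have h3 : Num.floor (b 0 i) <= Num.ceil (b 0 i).
  by rewrite -(ler_int R) (le_trans (floor_le _)) ?ceil_ge.
by rewrite h1 h2 (le_trans h1 h3) (le_trans h3 h2).
Qed.

Lemma in_Ecell j s : celldim 0 j s -> orb s \in Ecell j.
Proof.
move=> ds; rewrite /Ecell in_fset_set; last exact: finite_Ecell.
by apply/mem_set; exists s.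
Qed.

Lemma EcellP j o : o \in Ecell j -> celldim 0 j (orep o).
Proof.
rewrite /Ecell in_fset_set; last exact: finite_Ecell.
move=> /set_mem[s ds so]; have [m ->] : exists m : 'rV[int]_n,
    orep o = shift (m *m rays X) s by apply/orb_eq; rewrite orepK.
by rewrite -(celldim_eq 0 m) celldim_shift.
Qed.

Lemma in_Dcell a j s : fan_complete R X -> s \in Dcell a j <-> Dset a j s.
Proof.
move=> compl; rewrite /Dcell in_fset_set; last exact: finite_Dset.
by split=> [/set_mem|/mem_set].
Qed.

End Cells.
(* Complexes of graded modules, in nonnegative homological degrees, over a ring
   S graded by P; [homogeneous e x] says that x has degree e. *)
Record gcomplex (S : nzRingType) (P : zmodType) := GComplex {
  term : nat -> lmodType S;
  homogeneous : forall j, P -> set (term j);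
  diff : forall j, {linear term j.+1 -> term j};
  diff_homogeneous : forall j e x,
    homogeneous e x -> homogeneous e (diff j x);
  diff_diff : forall j x, diff j (diff j.+1 x) = 0 }.
Arguments homogeneous {S P} C {j} e x : rename.
Arguments diff {S P} C j : rename.

(* C(d)_e = C_(d + e) *)
Definition twist (S : nzRingType) (P : zmodType) (d : P) (C : gcomplex S P) :
  gcomplex S P :=
  @GComplex S P (term C) (fun j e => homogeneous C (d + e)) (diff C)
    (fun j e => @diff_homogeneous S P C j (d + e)) (@diff_diff S P C).

Definition gcomplex_iso (S : nzRingType) (P : zmodType)
    (C C' : gcomplex S P) : Prop :=
  exists f : forall j, {linear term C j -> term C' j},
    [/\ forall j, bijective (f j),
        forall j e (x : term C j),
          homogeneous C e x <-> homogeneous C' e (f j x) &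
        forall j x, f j (diff C j x) = diff C' j (f j.+1 x)].

(* the total coordinate ring S of X, and S (x) S with the right factor S
   written as k[y_1, ..., y_r], hence S (x) S = S[y_1, ..., y_r] *)
Notation cox k r := {mpoly k[r]} (only parsing).
Notation cox2 k r := {mpoly {mpoly k[r]}[r]} (only parsing).

Section Monomials.
Variables (k : closedFieldType) (n r : nat) (X : fan n r).
Local Notation S := (cox k r).
Local Notation S2 := (cox2 k r).
Implicit Types (a b : 'rV[int]_r) (e : Pic X).

(* x^a; only meaningful for a >= 0 *)
Definition mnmz a : 'X_{1..r} := [multinom absz (a ord0 i) | i < r].
Definition xmon a : S := 'X_[mnmz a].
Definition tmon a b : S2 := xmon a *: 'X_[mnmz b].

Definition zmnm (m : 'X_{1..r}) : 'rV[int]_r := \row_i (m i)%:Z.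

(* Every monomial of p has degree e in Pic X: for p : S this is p \in S_e, for
   p : S2 it is p \in S (x) S_e. *)
Definition is_deg (T : nzRingType) e (p : {mpoly T[r]}) : bool :=
  all (fun m => deg X (zmnm m) == e) (msupp p).
(* p \in S_e (x) S *)
Definition is_degl e (p : S2) : Prop := forall m, is_deg e p@_m.

Definition nonneg a := forall i, 0 <= a 0 i.

Lemma mnmzD a b : nonneg a -> nonneg b ->
  mnmz (a + b) = (mnmz a + mnmz b)%MM.
Proof.
move=> a0 b0; apply/mnmP => i; rewrite mnmDE !mnmE mxE.
by apply/eqP; rewrite -eqz_nat PoszD !gez0_abs ?addr_ge0 ?a0 ?b0.
Qed.

Lemma zmnmK a : nonneg a -> zmnm (mnmz a) = a.
Proof. by move=> a0; apply/rowP => i; rewrite mxE mnmE gez0_abs ?a0. Qed.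

Lemma zmnmD m m' : zmnm (m + m')%MM = zmnm m + zmnm m'.
Proof. by apply/rowP => i; rewrite !mxE mnmDE PoszD. Qed.

Lemma xmonD a b : nonneg a -> nonneg b -> xmon (a + b) = xmon a * xmon b.
Proof. by move=> a0 b0; rewrite /xmon mnmzD // mpolyXD. Qed.

Lemma tmonM a b a' b' : nonneg a -> nonneg b -> nonneg a' -> nonneg b' ->
  tmon a b * tmon a' b' = tmon (a + a') (b + b').
Proof.
move=> *; rewrite /tmon xmonD // mnmzD // mpolyXD.
by rewrite -scalerAl -scalerAr scalerA.
Qed.

Section Homogeneous.
Variable (T : nzRingType).
Implicit Types p q : {mpoly T[r]}.

Lemma is_degP e p :
  reflect (forall m, p@_m != 0 -> deg X (zmnm m) = e) (is_deg e p).
Proof.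
apply: (iffP allP) => H m; first by rewrite -mcoeff_msupp => /H/eqP.
by move=> mp; rewrite H -?mcoeff_msupp.
Qed.

Lemma is_deg0 e : is_deg e (0 : {mpoly T[r]}).
Proof. by apply/is_degP => m; rewrite mcoeff0 eqxx. Qed.

Lemma is_degD e p q : is_deg e p -> is_deg e q -> is_deg e (p + q).
Proof.
move=> /is_degP Hp /is_degP Hq; apply/is_degP => m; rewrite mcoeffD.
have [pm|/Hp//] := eqVneq p@_m 0; have [qm|/Hq//] := eqVneq q@_m 0.
by rewrite pm qm addr0 eqxx.
Qed.

Lemma is_degZ e c p : is_deg e p -> is_deg e (c *: p).
Proof.
move=> /is_degP Hp; apply/is_degP => m; rewrite mcoeffZ.
by have [->|/Hp//] := eqVneq p@_m 0; rewrite mulr0 eqxx.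
Qed.

Lemma is_deg_sum e (I : Type) (s : seq I) (P : pred I) (F : I -> {mpoly T[r]}) :
  (forall i, P i -> is_deg e (F i)) -> is_deg e (\sum_(i <- s | P i) F i).
Proof.
move=> H; apply: (big_ind (fun p => is_deg e p)) => //.
  exact: is_deg0.
by move=> *; apply: is_degD.
Qed.

Lemma is_degMX e m p : is_deg e p -> is_deg (e + deg X (zmnm m)) (p * 'X_[m]).
Proof.
move=> /allP Hp; apply/allP => m'.
rewrite (perm_mem (msuppMX p m)) => /mapP[u /Hp/eqP <- ->].
by rewrite zmnmD degD addrC.
Qed.

End Homogeneous.
End Monomials.

Section Degrees.
Variables (k : closedFieldType) (n r : nat) (X : fan n r).
Local Notation S := (cox k r).
Local Notation S2 := (cox2 k r).
Implicit Types (a b : 'rV[int]_r) (e : Pic X).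

Lemma is_degMz (T : nzRingType) e (c : int) (p : {mpoly T[r]}) :
  is_deg e p -> is_deg e (c%:~R * p).
Proof.
by move=> H; rewrite -[c%:~R](rmorph_int (@mpolyC r T)) mul_mpolyC is_degZ.
Qed.

Lemma is_degM_xmon e b (p : S) : nonneg b -> is_deg e p ->
  is_deg (e + deg X b) (xmon k b * p).
Proof. by move=> b0 Hp; rewrite mulrC -{1}(zmnmK b0) is_degMX. Qed.

Lemma is_degM_tmon e a b (p : S2) : nonneg b -> is_deg e p ->
  is_deg (e + deg X b) (tmon k a b * p).
Proof.
move=> b0 Hp; rewrite -scalerAl mulrC is_degZ //.
by rewrite -{1}(zmnmK b0) is_degMX.
Qed.

Lemma mcoeffMX_eq0 (T : nzRingType) (p : {mpoly T[r]}) u m :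
  ~~ (u <= m)%MM -> (p * 'X_[u])@_m = 0.
Proof.
move=> um; apply/eqP; apply: contraNT um; rewrite -mcoeff_msupp.
rewrite (perm_mem (msuppMX p u)) => /mapP[v _ ->].
by apply/mnm_lepP => i; rewrite mnmDE leq_addr.
Qed.

Lemma is_deglM_tmon e a b (p : S2) : nonneg a -> is_degl e p ->
  is_degl (e + deg X a) (tmon k a b * p).
Proof.
move=> a0 Hp m; rewrite -scalerAl mulrC mcoeffZ; apply: is_degM_xmon => //.
have [le|/mcoeffMX_eq0->] := boolP (mnmz b <= m)%MM; last exact: is_deg0.
by rewrite -[m](submK le) addmC mcoeffMX.
Qed.

Lemma is_degl_sum e (I : Type) (s : seq I) (P : pred I) (F : I -> S2) :
  (forall i, P i -> is_degl e (F i)) -> is_degl e (\sum_(i <- s | P i) F i).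
Proof.
by move=> H m; rewrite raddf_sum /=; apply: is_deg_sum => i /H; apply.
Qed.

Lemma is_deglMz e (c : int) (p : S2) :
  is_degl e p -> is_degl e (c%:~R * p).
Proof.
move=> H m; rewrite -[c%:~R](rmorph_int (@mpolyC r S)) mul_mpolyC mcoeffZ.
exact: is_degMz.
Qed.

End Degrees.

Lemma big_sub_fset (V : nmodType) (K : choiceType) (A B : {fset K})
    (G : K -> V) : {subset B <= A} ->
  \sum_(t : A | val t \in B) G (val t) = \sum_(t <- B) G t.
Proof.
move=> BA; rewrite -(big_seq_fsetE _ _ (fun t => t \in B) G) -big_filter.
apply: perm_big; apply: uniq_perm; rewrite ?filter_uniq ?fset_uniq //.
by move=> t; rewrite mem_filter andb_idr // => /BA.
Qed.

Section Facets.
Variables (R : realType) (n r : nat) (X : fan n r).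

Lemma in_facets_shift (a v : 'rV[int]_r) s t :
  (shift v t \in facets R X (a + v) (shift v s)) = (t \in facets R X a s).
Proof. by apply/idP/idP; rewrite !in_facets is_facet_shift. Qed.

Lemma big_facets_shift (V : nmodType) (a v : 'rV[int]_r) s (G : cell r -> V) :
  \sum_(t <- facets R X (a + v) (shift v s)) G t =
  \sum_(t <- facets R X a s) G (shift v t).
Proof.
rewrite -(big_map (shift v) xpredT G); apply: perm_big.
apply: uniq_perm; rewrite ?map_inj_uniq ?fset_uniq //.
  exact: can_inj (shiftK v).
move=> t; rewrite -{1}[t](shiftNK v) in_facets_shift.
apply/idP/mapP => [H|[u H ->]]; last by rewrite shiftK.
by exists (shift (- v) t); rewrite ?shiftNK.
Qed.

Lemma facets_eq (a : 'rV[int]_r) (m : 'rV[int]_n) s :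
  facets R X (a + m *m rays X) s = facets R X a s.
Proof. by rewrite /facets is_facet_eq. Qed.

Lemma big_facets0_shift (V : nmodType) (m : 'rV[int]_n) s (G : cell r -> V) :
  \sum_(t <- facets R X 0 (shift (m *m rays X) s)) G t =
  \sum_(t <- facets R X 0 s) G (shift (m *m rays X) t).
Proof. by rewrite -(facets_eq 0 m) big_facets_shift. Qed.

Lemma torus_diff_diff (T : comNzRingType) (c : cell r -> cell r -> T) j
    (g : Ecell R X j.+2 -> T) (q : orbit X) :
  (forall (m : 'rV[int]_n) s t,
     c (shift (m *m rays X) s) (shift (m *m rays X) t) = c s t) ->
  (forall s t, t \notin facets R X 0 s -> c s t = 0) ->
  (forall s u, \sum_(t <- facets R X 0 s) c t u * c s t = 0) ->
  \sum_(t : Ecell R X j.+1)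
    \sum_(u <- facets R X 0 (orep (val t)) | orb X u == q)
      c (orep (val t)) u * (\sum_(s : Ecell R X j.+2)
        \sum_(w <- facets R X 0 (orep (val s)) | orb X w == val t)
          c (orep (val s)) w * g s) = 0.
Proof.
move=> c_shift c_out c_codim2.
pose inner t := \sum_(u <- facets R X 0 t | orb X u == q) c t u.
have inner_orb t t' : orb X t = orb X t' -> inner t = inner t'.
  move=> /orb_eq[m ->]; rewrite /inner big_mkcond [RHS]big_mkcond /=.
  rewrite [RHS]big_facets0_shift; apply: eq_bigr => u _.
  rewrite c_shift (_ : orb X (shift (m *m rays X) u) = orb X u) //.
  by apply/esym/orb_eq; exists m.
transitivity (\sum_(s : Ecell R X j.+2) \sum_(t <- facets R X 0 (orep (val s)))
    inner t * c (orep (val s)) t * g s).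
  transitivity (\sum_(t : Ecell R X j.+1) \sum_(s : Ecell R X j.+2)
      \sum_(w <- facets R X 0 (orep (val s)) | orb X w == val t)
        inner w * c (orep (val s)) w * g s).
    apply: eq_bigr => t _; rewrite -big_distrl big_distrr /=.
    apply: eq_bigr => s _; rewrite big_distrr /=.
    apply: eq_bigr => w /eqP wt; rewrite -mulrA; congr (_ * _).
    by apply: inner_orb; rewrite orepK wt.
  rewrite exchange_big /=; apply: eq_bigr => s _.
  rewrite (exchange_big_dep xpredT) //= !big_seq; apply: eq_bigr => w ws.
  have dw : celldim R X 0 j.+1 w.
    have /in_facets[_ [j' [ds dw]]] := ws.
    by have [->] := celldim_inj (EcellP (valP s)) ds.
  by rewrite (big_pred1 (FSetSub (in_Ecell dw))) // => t; rewrite eq_sym.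
apply: big1 => s _; rewrite -big_distrl /=.
set s' := orep (val s).
pose B := (\bigcup_(t <- facets R X 0 s') facets R X 0 t)%fset.
rewrite (_ : \sum_(t <- _) _ = \sum_(u <- B | orb X u == q)
    \sum_(t <- facets R X 0 s') c t u * c s' t); last first.
  rewrite exchange_big /= !big_seq; apply: eq_bigr => t tc.
  rewrite big_distrl /= [LHS]big_mkcond [RHS]big_mkcond /=.
  apply: big_fset_incl => [|u _ ut].
    by apply/fsubsetP => u ut; apply/bigfcupP; exists t; rewrite ?tc.
  by case: ifP => // _; rewrite c_out // mul0r.
by rewrite big1 ?mul0r.
Qed.

End Facets.

Section Complexes.
Variables (R : realType) (k : closedFieldType) (n r : nat).
Variable X : smooth_projective_toric R n r.
Variable eps : incidence R X.
Local Notation S := (cox k r).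
Local Notation S2 := (cox2 k r).
Let complX : fan_complete R X := toric_complete X.

Lemma facet_nonneg (a : 'rV[int]_r) s t : is_facet R X a s t ->
  nonneg (hi s - hi t) /\ nonneg (lo t - lo s).
Proof.
move=> st; split=> i; have [h1 h2 h3] := facet_bounds i st.
- by rewrite !mxE subr_ge0.
- by rewrite !mxE subr_ge0.
Qed.

Section CellularComplex.
Variable a : 'rV[int]_r.

Definition eps_at (s t : cell r) : int := eps (shift (- a) s) (shift (- a) t).

Definition F_term j : lmodType S := {ffun Dcell R X a j -> S^o}.

(* the summand of s is S(- deg x^(hi s)) *)
Definition F_homogeneous j (e : Pic X) : set (F_term j) :=
  [set f | forall s : Dcell R X a j, is_deg (e - deg X (hi (val s))) (f s)].

Definition F_diff_fun j (f : F_term j.+1) : F_term j :=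
  [ffun t => \sum_(s : Dcell R X a j.+1 | val t \in facets R X a (val s))
     (eps_at (val s) (val t))%:~R * xmon k (hi (val s) - hi (val t)) * f s].

Fact F_diff_linear j : linear (@F_diff_fun j).
Proof.
move=> c f g; apply/ffunP => t; rewrite !ffunE scaler_sumr -big_split /=.
apply: eq_bigr => s _; rewrite !ffunE mulrDr.
by congr (_ + _); rewrite -[c *: f s]/(c * f s) -[LHS]/(_ * (c * f s)) mulrCA.
Qed.
HB.instance Definition _ j :=
  GRing.isLinear.Build S (F_term j.+1) (F_term j) *:%R (@F_diff_fun j)
    (@F_diff_linear j).

Definition F_diff j : {linear F_term j.+1 -> F_term j} := @F_diff_fun j.

Lemma Dset_facet j s t : Dset R X a j.+1 s -> is_facet R X a s t ->
  Dset R X a j t.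
Proof.
move=> [ds pos] [sub [j' [ds' dt]]]; split=> [|b /sub/pos//].
by have [->] := celldim_inj ds ds'.
Qed.

Lemma eps_at_out s t : t \notin facets R X a s -> eps_at s t = 0.
Proof.
move=> /negP st; apply: eps_out => H; apply: st; apply/in_facets.
by rewrite -(is_facet_shift _ _ a (- a)) subrr.
Qed.

Lemma eps_at_codim2 s q : \sum_(t <- facets R X a s) eps_at s t * eps_at t q = 0.
Proof.
have := @big_facets_shift R n r X int a (- a) s
  (fun t => eps (shift (- a) s) t * eps t (shift (- a) q)).
by rewrite (subrr a) (eps_codim2 eps) => <-.
Qed.

Fact F_diff_homogeneous j e (f : F_term j.+1) :
  F_homogeneous e f -> F_homogeneous e (F_diff j f).
Proof.
move=> H t; rewrite ffunE; apply: is_deg_sum => s st; rewrite -mulrA.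
apply: is_degMz.
have /in_facets/facet_nonneg[h _] := st.
have := is_degM_xmon h (H s).
by rewrite degD degN addrA subrK.
Qed.

Fact F_diff_diff j (f : F_term j.+2) : F_diff j (F_diff j.+1 f) = 0.
Proof.
apply/ffunP => q; rewrite !ffunE.
under eq_bigr => t _ do rewrite ffunE big_distrr /=.
rewrite (exchange_big_dep xpredT) //= big1 // => s _.
pose G (t : cell r) : S := (eps_at (val s) t * eps_at t (val q))%:~R *
  (xmon k (hi (val s) - hi (val q)) * f s).
transitivity (\sum_(t : Dcell R X a j.+1 | val t \in facets R X a (val s))
    G (val t)).
  rewrite big_mkcond [RHS]big_mkcond; apply: eq_bigr => t _.
  case st : (val t \in facets R X a (val s)); last by rewrite andbF.
  case tq : (val q \in facets R X a (val t)); last first.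
    by rewrite /G (eps_at_out (negbT tq)) mulr0 mulr0z !mul0r.
  have /in_facets/facet_nonneg[h1 _] : val t \in facets R X a (val s) by [].
  have /in_facets/facet_nonneg[h2 _] : val q \in facets R X a (val t) by [].
  have E : hi (val s) - hi (val q) =
      (hi (val s) - hi (val t)) + (hi (val t) - hi (val q)).
    by rewrite addrA subrK.
  by rewrite /G E (xmonD k h1 h2) intrM /=; ring.
etransitivity; first apply: big_sub_fset.
  move=> t /in_facets st; apply/in_Dcell => //; apply: Dset_facet st.
  exact/in_Dcell/(valP s).
by rewrite /G -big_distrl /= -rmorph_sum /= eps_at_codim2 mul0r.
Qed.

Definition F_complex : gcomplex S (Pic X) :=
  GComplex F_diff_homogeneous F_diff_diff.

End CellularComplex.

(* The resolution of the diagonal.  With c an interior point of orep o, the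
   summand of o is S(deg x^(floor (- c))) (x) S(deg x^(floor c)), where
   floor (- c) = - hi (orep o) and floor c = lo (orep o).  Neither the degree
   shifts nor the matrix coefficients change under translation by M. *)
Definition G_term j : lmodType S := {ffun Ecell R X j -> S2}.

Definition G_diff j (g : G_term j.+1) : G_term j :=
  [ffun o => \sum_(s : Ecell R X j.+1)
     \sum_(t <- facets R X 0 (orep (val s)) | orb X t == val o)
       (eps (orep (val s)) t)%:~R *
         tmon k (hi (orep (val s)) - hi t) (lo t - lo (orep (val s))) * g s].

Fact G_diff_linear j : linear (@G_diff j).
Proof.
move=> c f g; apply/ffunP => o; rewrite !ffunE scaler_sumr -big_split /=.
apply: eq_bigr => s _; rewrite scaler_sumr -big_split /=.
by apply: eq_bigr => t _; rewrite !ffunE mulrDr scalerAr.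
Qed.
HB.instance Definition _ j :=
  GRing.isLinear.Build S (G_term j.+1) (G_term j) *:%R (@G_diff j)
    (@G_diff_linear j).

Lemma deg_lo_orb s t : orb X s = orb X t -> deg X (lo s) = deg X (lo t).
Proof.
move=> /orb_eq[m ->]; apply/deg_eq; exists (- m).
by rewrite lo_shift opprD addrA subrr sub0r mulNmx.
Qed.

Lemma deg_hi_orb s t : orb X s = orb X t -> deg X (hi s) = deg X (hi t).
Proof.
move=> /orb_eq[m ->]; apply/deg_eq; exists (- m).
by rewrite hi_shift opprD addrA subrr sub0r mulNmx.
Qed.

Definition tcoef s t : S2 := (eps s t)%:~R * tmon k (hi s - hi t) (lo t - lo s).

Lemma tcoef_out s t : t \notin facets R X 0 s -> tcoef s t = 0.
Proof.
move=> /negP st; rewrite /tcoef eps_out ?mulr0z ?mul0r // => H.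
by apply: st; apply/in_facets.
Qed.

Lemma tcoef_shift (m : 'rV[int]_n) s t :
  tcoef (shift (m *m rays X) s) (shift (m *m rays X) t) = tcoef s t.
Proof.
have E (x y v : 'rV[int]_r) : (x + v) - (y + v) = x - y.
  by rewrite opprD addrACA subrr addr0.
by rewrite /tcoef (eps_shift eps) !lo_shift !hi_shift !E.
Qed.

Lemma tcoefM s t q : t \in facets R X 0 s -> tcoef s t * tcoef t q =
  (eps s t * eps t q)%:~R * tmon k (hi s - hi q) (lo q - lo s).
Proof.
move=> st; have [tq|tq] := boolP (q \in facets R X 0 t); last first.
  have e0 : eps t q = 0.
    by apply: eps_out => H; move/negP: tq; apply; apply/in_facets.
  by rewrite (tcoef_out tq) e0 !mulr0 mulr0z mul0r.
have /in_facets/facet_nonneg[h1 h2] := st.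
have /in_facets/facet_nonneg[h3 h4] := tq.
have -> : hi s - hi q = (hi s - hi t) + (hi t - hi q) by rewrite addrA subrK.
have -> : lo q - lo s = (lo t - lo s) + (lo q - lo t).
  by rewrite [RHS]addrC addrA subrK.
by rewrite -(tmonM k h1 h2 h3 h4) intrM [RHS]mulrACA.
Qed.

Fact G_diff_diff j (g : G_term j.+2) : G_diff (G_diff g) = 0.
Proof.
apply/ffunP => q; rewrite !ffunE.
under eq_bigr => t _ do under eq_bigr => u _ do rewrite ffunE.
apply: (torus_diff_diff (c := tcoef)) => [||s u]; first exact: tcoef_shift.
  exact: tcoef_out.
rewrite big_seq; under eq_bigr => t tc do rewrite mulrC tcoefM //.
by rewrite -big_seq -big_distrl /= -rmorph_sum /= (eps_codim2 eps) mul0r.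
Qed.

Section FourierMukai.
Variable d : Pic X.

(* The part of right degree d of G: the summand of o becomes
   S(deg x^(- hi)) (x) S_(d + deg x^lo), with S acting on the left factor. *)
Definition Phi_pred j : {pred G_term j} :=
  fun g => [forall o, is_deg (d + deg X (lo (orep (val o)))) (g o)].

Fact Phi_submod_closed j : submod_closed (@Phi_pred j).
Proof.
split=> [|c f g /forallP Hf /forallP Hg]; apply/forallP => o; rewrite !ffunE.
  exact: is_deg0.
apply: is_degD => //; apply/is_degP => m; rewrite mcoeffZ.
have [->|] := eqVneq (f o)@_m 0; first by rewrite mulr0 eqxx.
by move=> nz _; have /is_degP := Hf o; apply.
Qed.
HB.instance Definition _ j :=
  GRing.isSubmodClosed.Build S (G_term j) (@Phi_pred j) (@Phi_submod_closed j).

Definition Phi_type j : Type := {g : G_term j | g \in @Phi_pred j}.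
HB.instance Definition _ j := SubChoice.on (Phi_type j).
HB.instance Definition _ j := [SubChoice_isSubLmodule of Phi_type j by <:].
Definition Phi_term j : lmodType S := Phi_type j.

Definition Phi_homogeneous j (e : Pic X) : set (Phi_term j) :=
  [set g | forall o : Ecell R X j,
     is_degl (e + deg X (- hi (orep (val o)))) (val (g : Phi_type j) o)].

Fact G_diff_Phi j (g : G_term j.+1) :
  g \in @Phi_pred j.+1 -> G_diff g \in @Phi_pred j.
Proof.
move=> /forallP H; apply/forallP => o; rewrite ffunE.
apply: is_deg_sum => s _; rewrite big_seq_cond; apply: is_deg_sum => t.
move=> /andP[/in_facets/facet_nonneg[_ h] /eqP to]; rewrite -mulrA.
apply: is_degMz; have := is_degM_tmon (hi (orep (val s)) - hi t) h (H s).
rewrite -addrA -degD subrKC.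
by rewrite (@deg_lo_orb t (orep (val o))) // orepK.
Qed.

Definition Phi_diff_fun j (g : Phi_type j.+1) : Phi_type j :=
  exist _ (G_diff (val g)) (G_diff_Phi (valP g)).

Fact Phi_diff_linear j : linear (@Phi_diff_fun j).
Proof. by move=> c f g; apply: val_inj; rewrite /= !linearP. Qed.
HB.instance Definition _ j :=
  GRing.isLinear.Build S (Phi_type j.+1) (Phi_type j) *:%R (@Phi_diff_fun j)
    (@Phi_diff_linear j).

Definition Phi_diff j : {linear Phi_term j.+1 -> Phi_term j} :=
  @Phi_diff_fun j.

Fact Phi_diff_homogeneous j e (g : Phi_term j.+1) :
  Phi_homogeneous e g -> Phi_homogeneous e (Phi_diff j g).
Proof.
move=> H o; rewrite /= ffunE.
apply: is_degl_sum => s _; rewrite big_seq_cond; apply: is_degl_sum => t.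
move=> /andP[/in_facets/facet_nonneg[h _] /eqP to]; rewrite -mulrA.
apply: is_deglMz.
have := is_deglM_tmon (lo t - lo (orep (val s))) h (H s).
rewrite -addrA -degD addrA addNr add0r degN.
by rewrite (@deg_hi_orb t (orep (val o))) -?degN // orepK.
Qed.

Fact Phi_diff_diff j (g : Phi_term j.+2) : Phi_diff j (Phi_diff j.+1 g) = 0.
Proof. by apply: val_inj; rewrite /= G_diff_diff. Qed.

Definition Phi_complex : gcomplex S (Pic X) :=
  GComplex Phi_diff_homogeneous Phi_diff_diff.

End FourierMukai.
End Complexes.

(* Main.v *)
(* The cells of D lying over the cell [o] of E, i.e. the translates [s] by
   [alpha + M] of its representative that satisfy [lo s >= 0], correspond through
   [s |-> lo s] to the exponents of the monomials of degree [d + deg lo(o)], since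
   these exponents are the nonnegative points of [alpha + lo(o) + M].  So sending
   [e_s] to [1 (x) y^(lo s)] in the summand of [o] matches a basis of [F] with a
   basis of [Phi]; the differentials agree because the labels of [s] and [o]
   differ by the translation. *)
Require Import Defs.
From HB Require Import structures.
From mathcomp Require Import all_boot all_order all_algebra.
From mathcomp Require Import finmap mpoly.
From mathcomp Require Import boolp reals.

Set Implicit Arguments.
Unset Strict Implicit.
Unset Printing Implicit Defensive.

Import Order.TTheory GRing.Theory Num.Theory.
Local Open Scope ring_scope.

Lemma mnmzK (r : nat) : cancel (@zmnm r) (@mnmz r).
Proof. by move=> m; apply/mnmP => i; rewrite mnmE mxE. Qed.

Lemma mnmz_inj (r : nat) (a b : 'rV[int]_r) :
  nonneg a -> nonneg b -> mnmz a = mnmz b -> a = b.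
Proof. by move=> a0 b0 E; rewrite -(zmnmK a0) E zmnmK. Qed.

Section CellsOverTorus.
Variables (R : realType) (n r : nat) (X : smooth_projective_toric R n r).
Variable a : 'rV[int]_r.
Local Notation Dcell := (Dcell R X a).
Local Notation Ecell := (Ecell R X).

(** The lower corner [lo s] consists of the floors of an interior point and bounds the closed cell
    from below, so its sign decides containment in the orthant. *)
Lemma DcellP j s :
  s \in Dcell j <-> celldim R X a j s /\ nonneg (lo s).
Proof.
rewrite in_Dcell; last exact: toric_complete.
split=> -[ds pos]; split=> //.
  move=> i; have [b bs] := celldim_open ds.
  have [_ /(_ i)[<- _]] := bs.
  by rewrite floor_ge0 pos //; exact: opencell_closed.
move=> b [_ bs] i; have /andP[le _] := bs i; apply: le_trans le.
by rewrite ler0z.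
Qed.

Lemma Dcell_lo_ge0 j (s : Dcell j) : nonneg (lo (val s)).
Proof. by have /DcellP[] := valP s. Qed.

Lemma Dorb_subproof j (s : Dcell j) : orb X (shift (- a) (val s)) \in Ecell j.
Proof.
apply: in_Ecell; rewrite -(subrr a) celldim_shift.
by have /DcellP[] := valP s.
Qed.

Definition Dorb j (s : Dcell j) : Ecell j := FSetSub (Dorb_subproof s).

Lemma Dorb_rep j (s : Dcell j) : exists m : 'rV[int]_n,
  orep (val (Dorb s)) = shift (m *m rays X) (shift (- a) (val s)).
Proof. by apply/orb_eq; rewrite orepK. Qed.

(** Cells over one orbit differ by a translation from the image of [M]; equal lower corners make its
    vector zero. *)
Lemma Dorb_lo_inj j (s t : Dcell j) :
  Dorb s = Dorb t -> lo (val s) = lo (val t) -> s = t.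
Proof.
move=> /(congr1 val)/= /orb_eq[m E] Elo; apply: val_inj.
move: E; rewrite /shift /= => -[E1 E2].
have u0 : m *m rays X = 0.
  apply: (addrI (lo (val s) - a)); rewrite addr0.
  by rewrite [in RHS]Elo; exact/esym.
case: (val s) (val t) Elo E2 => f c [f' c'] /= Elo.
by rewrite u0 addr0 => /addIr; rewrite -Elo => ->.
Qed.

(** Equality of degrees provides the element [u] of [M] for which translation by [a + u *m rays X]
    moves the lower corner of the representative to the exponent [m]. That corner is nonnegative, so
    the translate lies in [D]. *)
Lemma Dorb_lo_surj j (o : Ecell j) (m : 'X_{1..r}) :
  deg X (zmnm m) = deg X a + deg X (lo (orep (val o))) ->
  exists2 s : Dcell j, Dorb s = o & mnmz (lo (val s)) = m.
Proof.
rewrite -degD => /deg_eq[u E].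
pose s := shift (a + u *m rays X) (orep (val o)).
have los : lo s = zmnm m.
  by rewrite /s lo_shift addrA [_ + a]addrC -E addrC subrK.
have sD : s \in Dcell j.
  apply/DcellP; split; last by rewrite los => i; rewrite mxE.
  rewrite -(celldim_eq R X a u) -[in X in celldim _ _ X](add0r (a + _)).
  by apply/celldim_shift/EcellP/valP.
exists (FSetSub sD); last by rewrite -[m]mnmzK -los.
apply: val_inj; rewrite /= -[RHS]orepK; apply/orb_eq; exists (- u).
rewrite /s mulNmx; case: (orep _) => f c; rewrite /shift /=.
by congr pair; rewrite addrAC addrA !addrK.
Qed.

End CellsOverTorus.

Section Iso.
Variables (R : realType) (k : closedFieldType) (n r : nat).
Variables (X : smooth_projective_toric R n r) (eps : incidence R X).
Variable a : 'rV[int]_r.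
Local Notation F j := (F_term k X a j).
Local Notation G j := (G_term k X j).
Local Notation d := (deg X a).

Definition F_to_G j (f : F j) : G j :=
  [ffun o => \sum_(s : Dcell R X a j | Dorb s == o)
     f s *: 'X_[mnmz (lo (val s))]].

(** Distinct cells over one orbit carry distinct monomials, so no other summand contributes. This
    recovers [f] from its image. *)
Lemma F_to_G_coef j (f : F j) (s : Dcell R X a j) :
  (F_to_G f (Dorb s))@_(mnmz (lo (val s))) = f s.
Proof.
rewrite ffunE raddf_sum (bigD1 s) //= mcoeffZ mcoeffX eqxx mulr1.
rewrite big1 ?addr0 // => t /andP[/eqP ts nts].
rewrite mcoeffZ mcoeffX; case: eqP => [E|_]; last by rewrite mulr0.
case/eqP: nts; apply: Dorb_lo_inj => //.
exact: mnmz_inj (Dcell_lo_ge0 _) (Dcell_lo_ge0 _) E.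
Qed.

Lemma deg_Dorb_lo j (s : Dcell R X a j) :
  deg X (lo (val s)) = d + deg X (lo (orep (val (Dorb s)))).
Proof.
rewrite -degD; apply/deg_eq; have [m ->] := Dorb_rep s; exists (- m).
by rewrite mulNmx !lo_shift [a + _]addrA subrKC opprD addrA subrr sub0r.
Qed.

Lemma deg_Dorb_hi j (s : Dcell R X a j) :
  deg X (hi (val s)) = d + deg X (hi (orep (val (Dorb s)))).
Proof.
rewrite -degD; apply/deg_eq; have [m ->] := Dorb_rep s; exists (- m).
by rewrite mulNmx !hi_shift [a + _]addrA subrKC opprD addrA subrr sub0r.
Qed.

Lemma F_to_G_Phi j (f : F j) : F_to_G f \in Phi_pred d (j := j).
Proof.
apply/forallP => o; rewrite ffunE; apply: is_deg_sum => s /eqP <-.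
apply: is_degZ; apply/is_degP => m; rewrite mcoeffX.
case: (_ =P m) => [<- _|_]; last by rewrite eqxx.
by rewrite zmnmK ?deg_Dorb_lo //; exact: Dcell_lo_ge0.
Qed.

Definition F_to_Phi j (f : F j) : Phi_type k d j :=
  exist _ (F_to_G f) (F_to_G_Phi f).

Fact F_to_Phi_linear j : linear (@F_to_Phi j).
Proof.
move=> c f g; apply: val_inj; apply/ffunP => o.
rewrite /= !ffunE scaler_sumr -big_split /=; apply: eq_bigr => s _.
by rewrite !ffunE scalerDl scalerA.
Qed.
HB.instance Definition _ j :=
  GRing.isLinear.Build {mpoly k[r]} (F j) (Phi_type k d j) *:%R (@F_to_Phi j)
    (@F_to_Phi_linear j).

Lemma F_to_Phi_bij j : bijective (@F_to_Phi j).
Proof.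
pose inv (g : Phi_type k d j) : F j :=
  [ffun s => (val g (Dorb s))@_(mnmz (lo (val s)))].
exists inv => [f|g].
  by apply/ffunP => s; rewrite ffunE F_to_G_coef.
apply: val_inj; apply/ffunP => o; apply/mpolyP => m.
have [[s <- <-]|no] :=
    pselect (exists2 s : Dcell R X a j, Dorb s = o & mnmz (lo (val s)) = m).
  by rewrite F_to_G_coef ffunE.
rewrite ffunE raddf_sum big1 /= => [|s /eqP so]; last first.
  rewrite mcoeffZ mcoeffX; case: eqP => [sm|_]; last by rewrite mulr0.
  by case: no; exists s.
(* A nonzero coefficient of [g] at [m] would force [m] to have degree [d + deg lo(o)], hence to come
   from a cell over [o]. *)
apply/esym/eqP/negPn/negP => nz; apply: no; apply: Dorb_lo_surj.
by have /forallP/(_ o)/is_degP := valP g; apply.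
Qed.

(** Translating by [a] changes the class of the label by [d], which the twist by [d] compensates. *)
Lemma F_to_Phi_homogeneous j e (f : F j) :
  F_homogeneous (d + e) f <-> Phi_homogeneous e (F_to_Phi f).
Proof.
have E (s : Dcell R X a j) : d + e - deg X (hi (val s)) =
    e + deg X (- hi (orep (val (Dorb s)))).
  by rewrite deg_Dorb_hi degN opprD addrA [d + e]addrC addrK.
split=> H; last first.
  by move=> s; rewrite E -F_to_G_coef; apply: H.
move=> o m; rewrite ffunE raddf_sum /=; apply: is_deg_sum => s /eqP <-.
rewrite -E mcoeffZ mcoeffX; case: eqP => _; last by rewrite mulr0 is_deg0.
by rewrite mulr1; apply: H.
Qed.

(** The sign is invariant under [M], [eps_at] absorbs the shift by [- a], and the exponents are
    differences, in which translations cancel. *)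
Lemma tcoef_Dorb j (s : Dcell R X a j.+1) (m : 'rV[int]_n) t :
  orep (val (Dorb s)) = shift (m *m rays X) (shift (- a) (val s)) ->
  tcoef k eps (orep (val (Dorb s))) (shift (m *m rays X) (shift (- a) t)) =
  (eps_at eps a (val s) t)%:~R *
    tmon k (hi (val s) - hi t) (lo t - lo (val s)).
Proof.
move=> ->; rewrite tcoef_shift /tcoef /eps_at !hi_shift !lo_shift.
by rewrite !opprD !addrA ![_ - a + _]addrAC !addrNK; congr (_ * tmon _ _ _);
  rewrite opprK !addrAC subrK.
Qed.

Lemma F_to_G_diff j (f : F j.+1) :
  F_to_G (F_diff k eps a j f) = G_diff eps (F_to_G f).
Proof.
apply/ffunP => o; rewrite !ffunE.
under eq_bigr => t _ do rewrite ffunE scaler_suml.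
rewrite (exchange_big_dep xpredT) //=.
(* Both sides are brought to a sum over cells of [D] and the facets of their torus
   representatives. *)
transitivity (\sum_(s : Dcell R X a j.+1)
    \sum_(t <- facets R X 0 (orep (val (Dorb s))) | orb X t == val o)
      tcoef k eps (orep (val (Dorb s))) t * (f s *: 'X_[mnmz (lo (val s))]));
  last first.
  rewrite (partition_big (@Dorb _ _ _ _ a j.+1) xpredT) //=.
  apply: eq_bigr => o' _.
  under [RHS]eq_bigr => t _ do rewrite ffunE big_distrr /=.
  rewrite [RHS]exchange_big /=.
  by apply: eq_bigr => s /eqP <-.
apply: eq_bigr => s _; have [m Em] := Dorb_rep s.
rewrite [RHS]big_mkcond {1}Em big_facets0_shift.
rewrite -[X in facets _ _ X (shift _ _)](subrr a) big_facets_shift.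
(* [D] is closed under taking facets, so restricting the boundary to [D] loses no term of the torus
   differential. *)
have sub : {subset facets R X a (val s) <= Dcell R X a j}.
  move=> t /in_facets st; apply/in_Dcell; first exact: toric_complete.
  by apply: Dset_facet st; apply/in_Dcell/(valP s)/toric_complete.
rewrite -(big_sub_fset _ sub) big_mkcond [RHS]big_mkcond; apply: eq_bigr => t _.
rewrite tcoef_Dorb // andbC -if_and -!val_eqE /=.
rewrite (_ : orb X (shift (m *m _) _) = orb X (shift (- a) (val t))); last first.
  by apply/esym/orb_eq; exists m.
case: ifP => // /andP[/in_facets/facet_nonneg[_ h] _].
(* The monomial of [lo t] factors through that of [lo s]. Since [mnmz] takes absolute values, both
   exponents must be nonnegative. *)
rewrite -[X in mnmz X](subrK (lo (val s))) mnmzD //; last exact: Dcell_lo_ge0.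
rewrite mpolyXD /tmon -[LHS]scalerA -!mulrA !mulrzl -scalerMzl; congr (_ *~ _).
by rewrite -scalerAl -scalerAr.
Qed.

End Iso.

Theorem theorem5p1 (R : realType) (k : closedFieldType) (n r : nat)
    (X : smooth_projective_toric R n r) (eps : incidence R X)
    (d : Pic X) (d_nef : nef d)
    (alpha : 'rV[int]_r) (deg_alpha : deg X alpha = d) :
  gcomplex_iso (twist d (F_complex k eps alpha)) (Phi_complex k eps d).
Proof.
subst d.
exists (fun j => (@F_to_Phi R k n r X alpha j :
  {linear F_term k X alpha j -> Phi_term k _ j})).
split=> [j|j e x|j x].
- exact: F_to_Phi_bij.
- exact: F_to_Phi_homogeneous.
- by apply: val_inj; rewrite /= F_to_G_diff.
Qed.
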